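(* $$\frac{4\pi}{\sqrt{3}} = \sum_{k=0}^{\infty}\left(-\frac14\right)^{k}\frac{\left(\frac43\right)_k}{\left(\frac76\right)_k}\cdot\frac{30k^2+45k+16}{(k+1)(2k+1)(3k+2)}.$$
   Context: For $k\in\mathbb{N}_0$, $(\alpha)_k=\alpha(\alpha+1)\cdots(\alpha+k-1)$ is the rising factorial (Pochhammer symbol), with $(\alpha)_0=1$. *)

(* Defs.v *)
From Stdlib Require Import Reals.
From Coquelicot Require Import Coquelicot.
Open Scope R_scope.

Fixpoint pochhammer (a : R) (k : nat) : R :=
  match k with
  | O => 1
  | S j => pochhammer a j * (a + INR j)
  end.

(* Main.v *)
Require Import Defs.
From Stdlib Require Import Reals Lra Lia.
From Coquelicot Require Import Coquelicot.
Open Scope R_scope.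

(** With [Phi(n,k)] a quotient of Pochhammer symbols, [F] and [G] below form a
    Wilf-Zeilberger pair, [F(n,k+1) - F(n,k) = G(n+1,k) - G(n,k)].  Summing it
    over a rectangle that grows to the quadrant gives
    [sum_k G(0,k) = sum_n F(n,0)].  The left-hand side is the required series
    up to a factor and a telescoping term, and the right-hand side is the slow
    series [4/3 sum_n (-1)^n (1/(n+1) + 1/(n+4/3)) = 4/3 (3 - PI / sqrt 3)],
    which is an elementary integral. *)

(* Coquelicot's lemmas on [sum_n] leave equalities typed in [R_AbelianGroup],
   which [ring] and [field] do not recognize. *)
Ltac real_eq := match goal with |- ?a = ?b => change (@eq R a b) end.

(** * Positivity, and summation of a Wilf-Zeilberger pair over a finite rectangle *)

Lemma pochhammer_pos (a : R) (k : nat) : 0 < a -> 0 < pochhammer a k.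
Proof.
intros ha; induction k as [|k IH]; simpl; [lra|].
pose proof (pos_INR k); apply Rmult_lt_0_compat; lra.
Qed.

(** Summing the pair relation over [n] telescopes [G], then summing over [k] telescopes [F]. The
    edges [F n (S K)] and [G (S N) k] are the errors to be controlled. *)
Lemma wz_sum (F G : nat -> nat -> R) :
  (forall n k, F n (S k) - F n k = G (S n) k - G n k) ->
  forall N K, sum_n (fun k => G 0%nat k) K =
    sum_n (fun n => F n 0%nat) N - sum_n (fun n => F n (S K)) N
    + sum_n (fun k => G (S N) k) K.
Proof.
intros wz N.
assert (column : forall k, sum_n (fun n => F n (S k)) N - sum_n (fun n => F n k) N
                           = G (S N) k - G 0%nat k).
{ intros k; induction N as [|N IH].
  - rewrite !sum_O; apply wz.
  - rewrite !sum_Sn; unfold plus; simpl; specialize (wz (S N) k); lra. }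
intros K; induction K as [|K IH].
- rewrite !sum_O; specialize (column 0%nat); lra.
- rewrite !sum_Sn; unfold plus; simpl; specialize (column (S K)); lra.
Qed.

Lemma sum_n_Rabs_le (u v : nat -> R) :
  (forall n, Rabs (u n) <= v n) -> forall N, Rabs (sum_n u N) <= sum_n v N.
Proof.
intros h N; induction N as [|N IH].
- rewrite !sum_O; apply h.
- rewrite !sum_Sn; unfold plus; simpl.
  eapply Rle_trans; [apply Rabs_triang|]; specialize (h (S N)); lra.
Qed.

(** * The concrete Wilf-Zeilberger pair *)

Definition wzPhi (n k : nat) : R :=
  pochhammer 1 n * pochhammer (4 / 3) n
  * (pochhammer 1 (2 * k) * pochhammer (2 / 3) k * pochhammer (1 / 3) k)
  / (pochhammer (7 / 3) (n + 2 * k) * pochhammer 2 (n + 2 * k)).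

(** For fixed [k] this is very-well-poised in [n]: with a = 2k + 7/3, the linear factor is a + 2n,
    and the pairs 1, 2k + 7/3 and 4/3, 2k + 2 both sum to a + 1. *)
Definition wzF (n k : nat) : R :=
  (-1) ^ n * (-1) ^ k * (2 * INR n + 2 * INR k + 7 / 3) * wzPhi n k.

(* [wzP], found by solving the linear system for its coefficients, makes
   [wzG / wzF] the rational certificate of the pair. *)
Definition wzP (x y : R) : R :=
  68 / 9 + 27 * y + 89 / 3 * y ^ 2 + 10 * y ^ 3
  + (107 / 9 + 85 / 3 * y + 16 * y ^ 2) * x + (6 + 7 * y) * x ^ 2 + x ^ 3.

Definition wzG (n k : nat) : R :=
  (-1) ^ n * (-1) ^ k * wzPhi n k * wzP (INR n) (INR k)
  / ((INR n + 2 * INR k + 7 / 3) * (INR n + 2 * INR k + 2)).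

Lemma wzPhi_pos (n k : nat) : 0 < wzPhi n k.
Proof.
unfold wzPhi; apply Rdiv_lt_0_compat;
  repeat apply Rmult_lt_0_compat; apply pochhammer_pos; lra.
Qed.

Lemma wzPhi_Sn (n k : nat) :
  wzPhi (S n) k = wzPhi n k * ((INR n + 1) * (INR n + 4 / 3))
    / ((INR n + 2 * INR k + 7 / 3) * (INR n + 2 * INR k + 2)).
Proof.
unfold wzPhi.
replace (S n + 2 * k)%nat with (S (n + 2 * k)) by lia.
assert (0 < pochhammer (7 / 3) (n + 2 * k)) by (apply pochhammer_pos; lra).
assert (0 < pochhammer 2 (n + 2 * k)) by (apply pochhammer_pos; lra).
pose proof (pos_INR n); pose proof (pos_INR k).
cbn [pochhammer]; rewrite plus_INR, mult_INR; change (INR 2) with 2.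
field; repeat split; nra.
Qed.

Lemma wzPhi_Sk (n k : nat) :
  wzPhi n (S k) = wzPhi n k
    * ((2 * INR k + 1) * (2 * INR k + 2) * (INR k + 2 / 3) * (INR k + 1 / 3))
    / ((INR n + 2 * INR k + 7 / 3) * (INR n + 2 * INR k + 2)
       * ((INR n + 2 * INR k + 10 / 3) * (INR n + 2 * INR k + 3))).
Proof.
unfold wzPhi.
replace (n + 2 * S k)%nat with (S (S (n + 2 * k))) by lia.
replace (2 * S k)%nat with (S (S (2 * k))) by lia.
assert (0 < pochhammer (7 / 3) (n + 2 * k)) by (apply pochhammer_pos; lra).
assert (0 < pochhammer 2 (n + 2 * k)) by (apply pochhammer_pos; lra).
pose proof (pos_INR n); pose proof (pos_INR k).
cbn [pochhammer]; rewrite !S_INR, plus_INR, mult_INR; change (INR 2) with 2.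
field; repeat split; nra.
Qed.

(** Both shifts multiply [wzPhi] by a rational function, so dividing by [wzPhi n k] leaves an
    identity of rational functions. *)
Lemma wz_pair (n k : nat) : wzF n (S k) - wzF n k = wzG (S n) k - wzG n k.
Proof.
unfold wzF, wzG; rewrite wzPhi_Sn, wzPhi_Sk.
pose proof (pos_INR n); pose proof (pos_INR k).
rewrite !S_INR; unfold wzP; simpl pow.
field; repeat split; nra.
Qed.

(** * Bounds on the two far edges of the rectangle *)

Lemma wzF_abs (n k : nat) :
  Rabs (wzF n k) = (2 * INR n + 2 * INR k + 7 / 3) * wzPhi n k.
Proof.
unfold wzF; pose proof (pos_INR n); pose proof (pos_INR k).
pose proof (wzPhi_pos n k).
rewrite !Rabs_mult, !pow_1_abs, (Rabs_pos_eq (wzPhi n k)), Rabs_pos_eq; lra.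
Qed.

(** The ratio of consecutive terms in [n] is at most (n+1)/(n+3), and these ratios telescope. The
    shift to [S k] is essential: at [k = 0] the decay is only of order 1/n. *)
Lemma wzF_abs_le (n k : nat) :
  Rabs (wzF n (S k)) <= 2 * Rabs (wzF 0 (S k)) / ((INR n + 1) * (INR n + 2)).
Proof.
pose proof (pos_INR k).
induction n as [|n IH].
- right; simpl INR; field.
- pose proof (pos_INR n).
  refine (Rle_trans _ (Rabs (wzF n (S k)) * ((INR n + 1) / (INR n + 3))) _ _ _).
  + rewrite !wzF_abs, wzPhi_Sn, !S_INR.
    pose proof (wzPhi_pos n (S k)) as hp.
    set (x := INR n) in *; set (y := INR k) in *; set (p := wzPhi n (S k)) in *.
    (* The ratio bound with denominators cleared. The cubes of [x] cancel in the last factor, which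
       then has only nonnegative coefficients. *)
    assert (h : 0 <= p * (x + 1) *
      ((2 * x + 2 * (y + 1) + 7 / 3) * ((x + 2 * (y + 1) + 7 / 3) * (x + 2 * (y + 1) + 2))
       - (2 * (x + 1) + 2 * (y + 1) + 7 / 3) * (x + 4 / 3) * (x + 3))).
    { apply Rmult_le_pos; [nra|].
      ring_simplify.
      assert (0 <= x ^ 2) by nra; assert (0 <= y ^ 2) by nra.
      assert (0 <= x * y) by nra; assert (0 <= x ^ 2 * y) by nra.
      assert (0 <= x * y ^ 2) by nra; assert (0 <= y ^ 3) by nra.
      lra. }
    apply Rminus_le_0.
    match goal with |- 0 <= ?e =>
      replace e with (p * (x + 1) *
      ((2 * x + 2 * (y + 1) + 7 / 3) * ((x + 2 * (y + 1) + 7 / 3) * (x + 2 * (y + 1) + 2))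
       - (2 * (x + 1) + 2 * (y + 1) + 7 / 3) * (x + 4 / 3) * (x + 3))
       / ((x + 3) * ((x + 2 * (y + 1) + 7 / 3) * (x + 2 * (y + 1) + 2))))
       by (field; repeat split; nra) end.
    apply Rdiv_le_0_compat; [exact h|].
    repeat apply Rmult_lt_0_compat; lra.
  + rewrite S_INR.
    replace (2 * Rabs (wzF 0 (S k)) / ((INR n + 1 + 1) * (INR n + 1 + 2)))
      with (2 * Rabs (wzF 0 (S k)) / ((INR n + 1) * (INR n + 2))
            * ((INR n + 1) / (INR n + 3))) by (field; lra).
    apply Rmult_le_compat_r; [|exact IH].
    apply Rdiv_le_0_compat; lra.
Qed.

Lemma sum_inv_consecutive (c : R) (N : nat) :
  sum_n (fun n => c / ((INR n + 1) * (INR n + 2))) N = c - c / (INR N + 2).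
Proof.
induction N as [|N IH].
- rewrite sum_O; simpl INR; real_eq; field.
- rewrite sum_Sn, IH, S_INR; unfold plus; cbn -[INR].
  pose proof (pos_INR N); field; lra.
Qed.

(** The bound is uniform in [N], so it survives [N] tending to infinity with [k] fixed. *)
Lemma wzF_sum_abs_le (k N : nat) :
  Rabs (sum_n (fun n => wzF n (S k)) N) <= 2 * Rabs (wzF 0 (S k)).
Proof.
eapply Rle_trans.
- apply (sum_n_Rabs_le _ _ (fun n => wzF_abs_le n k)).
- rewrite sum_inv_consecutive.
  pose proof (pos_INR N); pose proof (Rabs_pos (wzF 0 (S k))).
  enough (0 <= 2 * Rabs (wzF 0 (S k)) / (INR N + 2)) by lra.
  apply Rdiv_le_0_compat; lra.
Qed.

(** The same ratio argument; without the linear factor of [wzF] it already works at [k = 0]. *)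
Lemma wzPhi_le (n k : nat) :
  wzPhi n k <= 2 * wzPhi 0 k / ((INR n + 1) * (INR n + 2)).
Proof.
pose proof (pos_INR k).
induction n as [|n IH].
- right; simpl INR; field.
- pose proof (pos_INR n); pose proof (wzPhi_pos n k).
  apply (Rle_trans _ (wzPhi n k * ((INR n + 1) / (INR n + 3)))).
  + rewrite wzPhi_Sn; unfold Rdiv; rewrite Rmult_assoc.
    apply Rmult_le_compat_l; [lra|].
    apply (Rmult_le_reg_r ((INR n + 3) *
      ((INR n + 2 * INR k + 7 / 3) * (INR n + 2 * INR k + 2)))); [nra|].
    field_simplify; [nra|lra|lra].
  + rewrite S_INR.
    replace (2 * wzPhi 0 k / ((INR n + 1 + 1) * (INR n + 1 + 2)))
      with (2 * wzPhi 0 k / ((INR n + 1) * (INR n + 2))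
            * ((INR n + 1) / (INR n + 3))) by (field; lra).
    apply Rmult_le_compat_r; [|exact IH].
    apply Rdiv_le_0_compat; lra.
Qed.

Lemma wzG_abs_le (n k : nat) :
  Rabs (wzG n k) <= 20 * (INR k + 1) ^ 3 * wzPhi 0 k / (INR n + 1).
Proof.
pose proof (pos_INR n); pose proof (pos_INR k).
pose proof (wzPhi_pos n k); pose proof (wzPhi_pos 0 k); pose proof (wzPhi_le n k).
set (d := (INR n + 2 * INR k + 7 / 3) * (INR n + 2 * INR k + 2)).
assert (0 < d) by (unfold d; nra).
(* In [n], [wzP] is cubic and [d] quadratic, so their quotient grows linearly; against the quadratic
   decay of [wzPhi] this leaves 1/(n+1). The factor in [k] is crude. *)
assert (hP : 0 <= wzP (INR n) (INR k) <= 10 * (INR k + 1) ^ 3 * (INR n + 2) * d).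
{ unfold wzP, d; set (x := INR n) in *; set (y := INR k) in *; clearbody x y.
  assert (mono : forall i j, 0 <= x ^ i * y ^ j)
    by (intros; apply Rmult_le_pos; apply pow_le; lra).
  split.
  - pose proof (mono 1%nat 1%nat); pose proof (mono 1%nat 2%nat);
    pose proof (mono 2%nat 1%nat); pose proof (mono 3%nat 0%nat);
    pose proof (mono 2%nat 0%nat);
    pose proof (mono 0%nat 2%nat); pose proof (mono 0%nat 3%nat); lra.
  - apply Rminus_le_0; ring_simplify.
    pose proof (mono 1%nat 1%nat); pose proof (mono 1%nat 2%nat);
    pose proof (mono 1%nat 3%nat); pose proof (mono 1%nat 4%nat);
    pose proof (mono 1%nat 5%nat);
    pose proof (mono 2%nat 1%nat); pose proof (mono 2%nat 2%nat);
    pose proof (mono 2%nat 3%nat); pose proof (mono 2%nat 4%nat);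
    pose proof (mono 3%nat 1%nat); pose proof (mono 3%nat 2%nat);
    pose proof (mono 3%nat 3%nat);
    pose proof (mono 2%nat 0%nat); pose proof (mono 3%nat 0%nat);
    pose proof (mono 0%nat 2%nat); pose proof (mono 0%nat 3%nat);
    pose proof (mono 0%nat 4%nat); pose proof (mono 0%nat 5%nat); lra. }
assert (e : Rabs (wzG n k) = wzPhi n k * (wzP (INR n) (INR k) / d)).
{ unfold wzG; fold d; unfold Rdiv.
  rewrite !Rabs_mult, !pow_1_abs, (Rabs_pos_eq (wzPhi n k)) by lra.
  rewrite (Rabs_pos_eq (wzP _ _)) by lra.
  rewrite (Rabs_pos_eq (/ d)) by (left; apply Rinv_0_lt_compat; lra); ring. }
rewrite e.
replace (20 * (INR k + 1) ^ 3 * wzPhi 0 k / (INR n + 1))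
  with (2 * wzPhi 0 k / ((INR n + 1) * (INR n + 2))
        * (10 * (INR k + 1) ^ 3 * (INR n + 2))) by (field; lra).
apply Rmult_le_compat; [lra| |lra|].
- apply Rdiv_le_0_compat; lra.
- apply Rle_div_l; lra.
Qed.

(** The constant may depend on [K], because [N] goes to infinity first. *)
Lemma wzG_sum_abs_le (K : nat) :
  exists C, forall N, Rabs (sum_n (fun k => wzG (S N) k) K) <= C / (INR N + 1).
Proof.
exists (sum_n (fun k => 20 * (INR k + 1) ^ 3 * wzPhi 0 k) K); intros N.
pose proof (pos_INR N).
eapply Rle_trans; [apply (sum_n_Rabs_le _ _ (fun k => wzG_abs_le (S N) k))|].
unfold Rdiv; rewrite (sum_n_mult_r (K := R_Ring)); rewrite S_INR.
apply Rmult_le_compat_l; [|apply Rinv_le_contravar; lra].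
(* The constant is nonnegative: it dominates the absolute value of a sum of zeros. *)
eapply Rle_trans; [apply Rabs_pos|apply (sum_n_Rabs_le (fun _ => 0))].
intros k; rewrite Rabs_R0; pose proof (pos_INR k); pose proof (wzPhi_pos 0 k).
apply Rmult_le_pos; [|lra]; apply Rmult_le_pos; [lra|apply pow_le; lra].
Qed.

(** * From the edge [n = 0] to the required series *)

Definition geomTerm (k : nat) : R :=
  (- (1 / 4)) ^ k * (pochhammer (4 / 3) k / pochhammer (7 / 6) k).

Lemma geomTerm_S (k : nat) :
  geomTerm (S k) = - (1 / 4) * ((INR k + 4 / 3) / (INR k + 7 / 6)) * geomTerm k.
Proof.
unfold geomTerm; simpl.
assert (0 < pochhammer (7 / 6) k) by (apply pochhammer_pos; lra).
pose proof (pos_INR k); field; lra.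
Qed.

Lemma geomTerm_abs_le (k : nat) : Rabs (geomTerm k) <= (1 / 2) ^ k.
Proof.
induction k as [|k IH].
- unfold geomTerm; simpl; rewrite Rabs_pos_eq; lra.
- rewrite geomTerm_S, Rabs_mult; simpl pow.
  pose proof (pos_INR k).
  apply Rmult_le_compat; [apply Rabs_pos|apply Rabs_pos| |exact IH].
  rewrite Rabs_mult, Rabs_Ropp, !Rabs_pos_eq;
    [|apply Rdiv_le_0_compat; lra|lra].
  (* The crude bound 2 turns the factor 1/4 into the ratio 1/2. *)
  enough ((INR k + 4 / 3) / (INR k + 7 / 6) <= 2) by lra.
  apply Rle_div_l; lra.
Qed.

(** Duplicating (1)_{2k}, (7/3)_{2k} and (2)_{2k} produces the power of 1/4; quotients such as
    (2/3)_k / (5/3)_k = 2/(3k+2) give the denominator. The induction compares term ratios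
    instead. *)
Lemma wzPhi_0_geomTerm (k : nat) :
  (-1) ^ k * wzPhi 0 k
  = 2 * geomTerm k / ((3 * INR k + 1) * (3 * INR k + 2) * (2 * INR k + 1)).
Proof.
induction k as [|k IH].
- unfold wzPhi, geomTerm; simpl; field.
- pose proof (pos_INR k).
  rewrite wzPhi_Sk, geomTerm_S, !S_INR; simpl INR; simpl pow.
  match goal with |- _ * (_ * ?a / ?b) = _ =>
    transitivity (- (a / b) * ((-1) ^ k * wzPhi 0 k)) end.
  + field; lra.
  + rewrite IH; field; lra.
Qed.

Definition telTerm (k : nat) : R := geomTerm k / (3 * INR k + 1).

(** Every term is a rational multiple of [geomTerm k], so only a rational identity has to be
    checked. *)
Lemma term_decomposition (k : nat) :
  (- (1 / 4)) ^ k * (pochhammer (4 / 3) k / pochhammer (7 / 6) k)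
  * ((30 * INR k ^ 2 + 45 * INR k + 16)
     / ((INR k + 1) * (2 * INR k + 1) * (3 * INR k + 2)))
  = - 3 * wzG 0 k - 12 * (telTerm (S k) - telTerm k).
Proof.
fold (geomTerm k); unfold telTerm, wzG; rewrite geomTerm_S, S_INR.
pose proof (pos_INR k).
replace ((-1) ^ 0 * (-1) ^ k * wzPhi 0 k) with ((-1) ^ k * wzPhi 0 k)
  by (simpl; ring).
rewrite wzPhi_0_geomTerm; unfold wzP; simpl (INR 0).
field; lra.
Qed.

(** The 12 comes from [telTerm 0 = 1]; it cancels the rational part of -3 * 4/3 * (3 - PI / sqrt 3),
    leaving the claimed value. *)
Lemma partial_sum_eq (N K : nat) :
  sum_n (fun k : nat =>
    (- (1 / 4)) ^ k * (pochhammer (4 / 3) k / pochhammer (7 / 6) k)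
    * ((30 * INR k ^ 2 + 45 * INR k + 16)
       / ((INR k + 1) * (2 * INR k + 1) * (3 * INR k + 2)))) K
  = 12 - 12 * telTerm (S K)
    - 3 * (sum_n (fun n => wzF n 0) N - sum_n (fun n => wzF n (S K)) N
           + sum_n (fun k => wzG (S N) k) K).
Proof.
rewrite <- (wz_sum _ _ wz_pair).
rewrite (sum_n_ext _ _ K term_decomposition).
assert (h0 : telTerm 0 = 1) by (unfold telTerm, geomTerm; simpl; field).
induction K as [|K IH].
- rewrite !sum_O, h0; real_eq; ring.
- rewrite !sum_Sn, IH; unfold plus; cbn -[telTerm wzG]; real_eq; ring.
Qed.

(** * The slow alternating series on the edge [k = 0] *)

Lemma wzF_0 (n : nat) :
  wzF n 0 = 4 / 3 * ((-1) ^ n * (/ (INR n + 1) + / (INR n + 4 / 3))).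
Proof.
assert (e : wzPhi n 0 = 4 / 3 / ((INR n + 1) * (INR n + 4 / 3))).
{ induction n as [|n IH].
  - unfold wzPhi; simpl; field.
  - pose proof (pos_INR n).
    rewrite wzPhi_Sn, IH, S_INR; simpl (INR 0); field; lra. }
unfold wzF; rewrite e; simpl (INR 0); simpl ((-1) ^ 0).
pose proof (pos_INR n); field; lra.
Qed.

(* The primitive of [3 x^2 / (1 - x + x^2)], whose expansion
   [3 x^2 (1 + x) / (1 + x^3)] integrates termwise to the alternating series. *)
Definition primitive (x : R) : R :=
  3 * x + 3 / 2 * ln (1 - x + x ^ 2) - sqrt 3 * atan ((2 * x - 1) / sqrt 3).

Lemma sqrt3_pos : 0 < sqrt 3.
Proof. apply sqrt_lt_R0; lra. Qed.

Lemma sqrt3_sqr : sqrt 3 * sqrt 3 = 3.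
Proof. apply sqrt_sqrt; lra. Qed.

Lemma is_derive_primitive (x : R) :
  is_derive primitive x (3 * x ^ 2 / (1 - x + x ^ 2)).
Proof.
pose proof sqrt3_pos as h; pose proof sqrt3_sqr as h2.
assert (0 < 1 - x + x ^ 2) by nra.
unfold primitive; auto_derive; [nra|].
simpl pow in *; set (r := sqrt 3) in *; clearbody r.
(* Exposing [r * r] allows it to be replaced by 3, and 3 + (2x-1)^2 = 4(1 - x + x^2). *)
match goal with |- context [r * ?e] =>
  replace (r * e) with (2 * (r * r) / (r * r + (2 * x - 1) ^ 2)) by (field; nra) end.
rewrite h2; field; split; nra.
Qed.

(** The logarithm vanishes at both ends, and the arctangents are PI/6 and -PI/6. *)
Lemma primitive_increment : primitive 1 - primitive 0 = 3 - PI / sqrt 3.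
Proof.
pose proof sqrt3_pos as h; pose proof sqrt3_sqr as h2.
assert (a : atan (1 / sqrt 3) = PI / 6).
{ rewrite <- tan_PI6; apply atan_tan; pose proof PI_RGT_0; lra. }
unfold primitive.
replace (1 - 1 + 1 ^ 2) with 1 by ring; replace (1 - 0 + 0 ^ 2) with 1 by ring.
replace ((2 * 1 - 1) / sqrt 3) with (1 / sqrt 3) by (field; lra).
replace ((2 * 0 - 1) / sqrt 3) with (- (1 / sqrt 3)) by (field; lra).
rewrite ln_1, atan_opp, a.
replace (PI / sqrt 3) with (sqrt 3 * sqrt 3 * PI / (3 * sqrt 3)) by (rewrite h2; field; lra).
field; lra.
Qed.

(** The exponents are three times the denominators, so the derivative has no denominators and is a
    geometric sum. *)
Definition powerSum (N : nat) (x : R) : R :=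
  sum_n (fun n => (-1) ^ n * (x ^ (3 * n + 3) / (INR n + 1)
                              + x ^ (3 * n + 4) / (INR n + 4 / 3))) N.

Lemma is_derive_powerTerm (n : nat) (x : R) :
  is_derive (fun x => (-1) ^ n * (x ^ (3 * n + 3) / (INR n + 1)
                                  + x ^ (3 * n + 4) / (INR n + 4 / 3))) x
    (3 * x ^ 2 * (1 + x) * (- x ^ 3) ^ n).
Proof.
pose proof (pos_INR n).
remember (3 * n + 2)%nat as p eqn:hp; remember (3 * n + 3)%nat as q eqn:hq.
rewrite hq; replace (3 * n + 3)%nat with (S p) by lia.
replace (3 * n + 4)%nat with (S q) by lia.
auto_derive; [easy|].
change (match p with 0%nat => 1 | S _ => INR p + 1 end) with (INR (S p)).
change (match q with 0%nat => 1 | S _ => INR q + 1 end) with (INR (S q)).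
rewrite hp, hq, !S_INR, !plus_INR, !mult_INR; simpl INR.
replace (- x ^ 3) with (-1 * x ^ 3) by ring.
rewrite Rpow_mult_distr, <- pow_mult, !pow_add.
field; lra.
Qed.

(** Since 1 + x^3 = (1+x)(1 - x + x^2), the factor 1 + x cancels from the geometric sum and the
    formula holds even at x = -1. *)
Lemma is_derive_powerSum (N : nat) (x : R) :
  is_derive (powerSum N) x
    (3 * x ^ 2 * (1 - (- x ^ 3) ^ S N) / (1 - x + x ^ 2)).
Proof.
assert (0 < 1 - x + x ^ 2) by nra.
induction N as [|N IH].
- apply (is_derive_ext (fun x => (-1) ^ 0 * (x ^ (3 * 0 + 3) / (INR 0 + 1)
                                  + x ^ (3 * 0 + 4) / (INR 0 + 4 / 3)))).
  { intros t; unfold powerSum; rewrite sum_O; reflexivity. }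
  replace (3 * x ^ 2 * (1 - (- x ^ 3) ^ 1) / (1 - x + x ^ 2))
    with (3 * x ^ 2 * (1 + x) * (- x ^ 3) ^ 0) by (simpl pow in *; field; lra).
  apply is_derive_powerTerm.
- apply (is_derive_ext (fun x => plus (powerSum N x)
      ((-1) ^ S N * (x ^ (3 * S N + 3) / (INR (S N) + 1)
                     + x ^ (3 * S N + 4) / (INR (S N) + 4 / 3))))).
  { intros t; unfold powerSum; rewrite sum_Sn; reflexivity. }
  replace (3 * x ^ 2 * (1 - (- x ^ 3) ^ S (S N)) / (1 - x + x ^ 2))
    with (plus (3 * x ^ 2 * (1 - (- x ^ 3) ^ S N) / (1 - x + x ^ 2))
               (3 * x ^ 2 * (1 + x) * (- x ^ 3) ^ S N)).
  2: { unfold plus; cbn -[pow].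
       change ((- x ^ 3) ^ S (S N)) with ((- x ^ 3) * (- x ^ 3) ^ S N).
       simpl (x ^ 3); simpl (x ^ 2) in *; field; lra. }
  apply (is_derive_plus (V := R_NormedModule)); [exact IH|apply is_derive_powerTerm].
Qed.

(** The mean value theorem for [g - f] takes the place of integrating the inequality. *)
Lemma increment_le (f g f' g' : R -> R) :
  (forall x, 0 <= x <= 1 -> is_derive f x (f' x)) ->
  (forall x, 0 <= x <= 1 -> is_derive g x (g' x)) ->
  (forall x, 0 <= x <= 1 -> f' x <= g' x) ->
  f 1 - f 0 <= g 1 - g 0.
Proof.
intros hf hg hle.
destruct (MVT_gen (fun x => g x - f x) 0 1 (fun x => g' x - f' x)) as [c [hc e]];
  rewrite ?Rmin_left, ?Rmax_right in * by lra.
- intros x hx; apply (is_derive_minus (V := R_NormedModule)); [apply hg|apply hf]; lra.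
- intros x hx.
  apply continuity_pt_filterlim.
  refine (ex_derive_continuous (V := R_NormedModule) (fun x => g x - f x) x _).
  exists (g' x - f' x); apply (is_derive_minus (V := R_NormedModule));
    [apply hg|apply hf]; lra.
- specialize (hle c hc); lra.
Qed.

Lemma alternating_sum_error (N : nat) :
  Rabs (sum_n (fun n => (-1) ^ n * (/ (INR n + 1) + / (INR n + 4 / 3))) N
        - (3 - PI / sqrt 3)) <= 4 / (INR N + 1).
Proof.
pose proof (pos_INR N).
assert (e : sum_n (fun n => (-1) ^ n * (/ (INR n + 1) + / (INR n + 4 / 3))) N
            = powerSum N 1 - powerSum N 0).
{ replace (powerSum N 0) with 0.
  - rewrite Rminus_0_r; apply sum_n_ext; intros n.
    rewrite !pow1; real_eq; field; pose proof (pos_INR n); lra.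
  - unfold powerSum; rewrite (sum_n_ext _ (fun _ => 0)), sum_n_const; [real_eq; ring|].
    intros n; rewrite !pow_i by lia; real_eq; field; pose proof (pos_INR n); lra. }
rewrite e, <- primitive_increment.
(* The remainder of the derivative has degree 2 + 3(N+1) in its numerator. *)
set (m := (3 * N + 5)%nat).
assert (hm : 0 < INR (S m) /\ INR N + 1 <= INR (S m)).
{ unfold m; rewrite S_INR, plus_INR, mult_INR; simpl INR; lra. }
(* Comparison function, used with [s = 1] above and [s = -1] below. *)
set (g := fun s x : R => s * (4 * x ^ S m / INR (S m))).
assert (hg : forall s x, is_derive (g s) x (s * (4 * x ^ m))).
{ intros s x; unfold g; clearbody m; auto_derive; [easy|].
  change (match m with 0%nat => 1 | S _ => INR m + 1 end) with (INR (S m)).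
  field; lra. }
assert (hd : forall x, is_derive (fun x => powerSum N x - primitive x) x
   (3 * x ^ 2 * (1 - (- x ^ 3) ^ S N) / (1 - x + x ^ 2) - 3 * x ^ 2 / (1 - x + x ^ 2))).
{ intros x; apply (is_derive_minus (V := R_NormedModule));
    [apply is_derive_powerSum|apply is_derive_primitive]. }
assert (hb : forall x, 0 <= x <= 1 ->
  Rabs (3 * x ^ 2 * (1 - (- x ^ 3) ^ S N) / (1 - x + x ^ 2)
        - 3 * x ^ 2 / (1 - x + x ^ 2)) <= 4 * x ^ m).
{ intros x hx.
  (* The minimum, at x = 1/2; it turns the coefficient 3 into 4. *)
  assert (3 / 4 <= 1 - x + x ^ 2) by (pose proof (pow2_ge_0 (x - 1 / 2)); lra).
  match goal with |- Rabs ?e <= _ =>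
    replace e with ((3 * x ^ 2 * - (- x ^ 3) ^ S N) * / (1 - x + x ^ 2)) by (field; lra) end.
  rewrite !Rabs_mult, !Rabs_Ropp, <- !RPow_abs, Rabs_Ropp, <- RPow_abs.
  rewrite (Rabs_pos_eq x), (Rabs_pos_eq 3) by lra.
  rewrite (Rabs_pos_eq (/ _)) by (left; apply Rinv_0_lt_compat; lra).
  rewrite <- pow_mult.
  replace (3 * x ^ 2 * x ^ (3 * S N)) with (3 * x ^ m)
    by (unfold m; replace (3 * N + 5)%nat with (2 + 3 * S N)%nat by lia; rewrite pow_add; ring).
  assert (0 <= x ^ m) by (apply pow_le; lra).
  apply Rle_div_l; [lra|]; nra. }
pose proof (increment_le _ (g 1) _ _ (fun x _ => hd x) (fun x _ => hg 1 x)) as up.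
pose proof (increment_le (g (-1)) _ _ _ (fun x _ => hg (-1) x) (fun x _ => hd x)) as lo.
assert (hN : 4 / INR (S m) <= 4 / (INR N + 1)).
{ apply Rmult_le_compat_l; [lra|]; apply Rinv_le_contravar; lra. }
assert (g1 : forall s, g s 1 - g s 0 = s * (4 / INR (S m))).
{ intros s; unfold g; rewrite pow1, pow_i by lia; field; lra. }
rewrite !g1 in *.
apply Rabs_le; split.
- enough (-1 * (4 / INR (S m)) <= powerSum N 1 - primitive 1 - (powerSum N 0 - primitive 0)) by lra.
  apply lo; intros x hx; specialize (hb x hx); apply Rabs_le_between in hb; lra.
- enough (powerSum N 1 - primitive 1 - (powerSum N 0 - primitive 0) <= 1 * (4 / INR (S m))) by lra.
  apply up; intros x hx; specialize (hb x hx); apply Rabs_le_between in hb; lra.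
Qed.

(** * Passage to the limit, first in [N] and then in [K] *)

Lemma le_of_le_add_harmonic (a b c : R) :
  (forall N : nat, a <= b + c / (INR N + 1)) -> a <= b.
Proof.
intros h; apply Rnot_lt_le; intros lt.
destruct (INR_unbounded (c / (a - b))) as [N hN].
specialize (h N); pose proof (pos_INR N).
apply (Rmult_gt_compat_r (a - b)) in hN; [|lra].
replace (c / (a - b) * (a - b)) with c in hN by (field; lra).
assert (h' : a - b <= c / (INR N + 1)) by lra.
apply Rle_div_r in h'; [|lra]; nra.
Qed.

Lemma wzF_0_abs_le (k : nat) : Rabs (wzF 0 k) <= 3 * (1 / 2) ^ k.
Proof.
pose proof (pos_INR k); pose proof (wzPhi_pos 0 k).
pose proof (geomTerm_abs_le k) as hq; pose proof (Rabs_pos (geomTerm k)).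
assert (e : wzPhi 0 k
  = 2 * Rabs (geomTerm k) / ((3 * INR k + 1) * (3 * INR k + 2) * (2 * INR k + 1))).
{ transitivity (Rabs ((-1) ^ k * wzPhi 0 k)).
  - rewrite Rabs_mult, pow_1_abs, Rabs_pos_eq; lra.
  - rewrite wzPhi_0_geomTerm; unfold Rdiv; rewrite !Rabs_mult.
    rewrite (Rabs_pos_eq 2), (Rabs_pos_eq (/ _)); [easy| |lra].
    left; apply Rinv_0_lt_compat; repeat apply Rmult_lt_0_compat; lra. }
rewrite wzF_abs, e; simpl (INR 0).
apply (Rle_trans _ (3 * Rabs (geomTerm k))); [|lra].
unfold Rdiv; rewrite <- Rmult_assoc; apply Rle_div_l.
- repeat apply Rmult_lt_0_compat; lra.
- set (y := INR k) in *; set (q := Rabs (geomTerm k)) in *.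
  assert (0 <= q * y /\ 0 <= q * y ^ 2 /\ 0 <= q * y ^ 3)
    by (repeat split; apply Rmult_le_pos; try apply pow_le; lra).
  lra.
Qed.

Lemma telTerm_abs_le (k : nat) : Rabs (telTerm k) <= (1 / 2) ^ k.
Proof.
pose proof (pos_INR k); apply (Rle_trans _ (Rabs (geomTerm k)));
  [|apply geomTerm_abs_le].
unfold telTerm, Rdiv; rewrite Rabs_mult, (Rabs_pos_eq (/ _))
  by (left; apply Rinv_0_lt_compat; lra).
apply Rle_div_l; [lra|]; pose proof (Rabs_pos (geomTerm k)); nra.
Qed.

Theorem mainTheorem14 :
  is_series
    (fun k : nat =>
       (- (1 / 4)) ^ k
       * (pochhammer (4 / 3) k / pochhammer (7 / 6) k)
       * ((30 * INR k ^ 2 + 45 * INR k + 16)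
          / ((INR k + 1) * (2 * INR k + 1) * (3 * INR k + 2))))
    (4 * PI / sqrt 3).
Proof.
set (t := fun k : nat => _).
(* Here 30 = 12 + 3 * 2 * 3: the telescoping term, and the edge of [wzF] at [S K]. *)
assert (bound : forall K, Rabs (sum_n t K - 4 * PI / sqrt 3) <= 30 * (1 / 2) ^ S K).
{ intros K; destruct (wzG_sum_abs_le K) as [C hC].
  (* The error vanishing with [N]: 16 = 3 * 4/3 * 4 from the slow series, and [3 * C] from the edge
     of [wzG]. *)
  apply (le_of_le_add_harmonic _ _ (16 + 3 * C)); intros N.
  pose proof (partial_sum_eq N K) as e; fold t in e; rewrite e; clear e.
  assert (h0 : sum_n (fun n => wzF n 0) N = 4 / 3 *
    sum_n (fun n => (-1) ^ n * (/ (INR n + 1) + / (INR n + 4 / 3))) N).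
  { rewrite (sum_n_ext _ _ N wzF_0); apply (sum_n_mult_l (K := R_Ring)). }
  rewrite h0.
  specialize (hC N); pose proof (alternating_sum_error N) as hA.
  pose proof (wzF_sum_abs_le K N) as hF; pose proof (wzF_0_abs_le (S K)).
  pose proof (telTerm_abs_le (S K)) as hT.
  apply Rabs_le_between in hC, hA, hF, hT.
  replace ((16 + 3 * C) / (INR N + 1)) with (4 * (4 / (INR N + 1)) + 3 * (C / (INR N + 1)))
    by (pose proof (pos_INR N); field; lra).
  replace (4 * PI / sqrt 3) with (4 * (PI / sqrt 3)) by (unfold Rdiv; ring).
  apply Rabs_le; split; lra. }
change (is_lim_seq (sum_n t) (4 * PI / sqrt 3)).
apply is_lim_seq_spec; intros eps.
assert (lim : is_lim_seq (fun K => 30 * (1 / 2) ^ S K) 0).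
{ replace (Finite 0) with (Rbar_mult 30 0) by (simpl; f_equal; ring).
  apply is_lim_seq_scal_l, (is_lim_seq_incr_1 (fun n => (1 / 2) ^ n)).
  apply is_lim_seq_geom; rewrite Rabs_pos_eq; lra. }
apply is_lim_seq_spec in lim; destruct (lim eps) as [n0 h0]; exists n0; intros n hn.
specialize (h0 n hn); rewrite Rminus_0_r in h0; apply Rabs_lt_between in h0.
specialize (bound n); lra.
Qed.
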